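(* Let $X$ be a Banach space with a $1$-unconditional Schauder basis. Then the Calkin algebra $\mathcal{B}(X)/\mathcal{K}(X)$ does not have the ball covering property (BCP).
   Context: A normed space $Z$ has the ball covering property (BCP) if its unit sphere $\{z\in Z:\|z\|=1\}$ can be covered by countably many open balls $B(z_i,r_i)$ with $r_i\le\|z_i\|$ for each $i$ (i.e. open balls none of which contains the origin). $\mathcal{B}(X)$ is the space of bounded linear operators on $X$ with the operator norm and $\mathcal{K}(X)$ the closed subspace of compact operators. The Calkin algebra $\mathcal{B}(X)/\mathcal{K}(X)$ carries the quotient norm, which is the essential norm $\|T\|_e=\inf\{\|T-K\|:K\in\mathcal{K}(X)\}$. Schauder bases are infinite sequences $(e_n)_{n\in\mathbb{N}}$ (so $X$ is infinite-dimensional). A Schauder basis $(e_n)$ is unconditional if there is a constant $C\ge 1$ such that $\|\sum a_ne_n\|\le C\|\sum b_ne_n\|$ for all scalar sequences $(a_n),(b_n)$ with $|a_n|\le|b_n|$ for all $n$ (for which the series converge); the best such $C$ is its unconditional constant. The basis is $1$-unconditional if this constant is $1$. *)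

(* Defs.v *)
From HB Require Import structures.
From mathcomp Require Import all_boot all_order all_algebra.
From mathcomp Require Import generic_quotient ring_quotient.
From mathcomp Require Import complex.
From mathcomp Require Import all_classical all_reals topology.
From mathcomp Require Import normedtype sequences.

Set Implicit Arguments.
Unset Strict Implicit.
Unset Printing Implicit Defensive.

Import Order.TTheory GRing.Theory Num.Theory.
Import numFieldNormedType.Exports.

Local Open Scope classical_set_scope.
Local Open Scope ring_scope.
Local Open Scope quotient_scope.

Inductive scalars := real_scalars | complex_scalars.

Definition scalar_field (R : realType) (F : scalars) : numFieldType :=
  match F with
  | real_scalars => R
  | complex_scalars => R[i]
  end.

(* In C the order is partial: z <= w means that w - z is a nonnegative real.
   Norms take their values in the nonnegative elements of the scalar field, so
   sups and infs of norms are the order-theoretic [supremum] and [infimum].  *)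
Section Infimum.
Variables (R : realType) (F : scalars).
Local Notation K := (scalar_field R F).
Implicit Types (A : set K) (x : K).

Lemma infimums_neq0 A : A !=set0 -> lbound A 0 -> infimums A !=set0.
Proof.
case: F A => /= A A0 lA.
  exists (inf A); split => [x Ax|y yA]; first exact: (ge_inf (ex_intro _ 0 lA) Ax).
  exact: lb_le_inf.
have reA (x : R[i]) : A x -> x = (complex.Re x)%:C%C.
  by move=> Ax; rewrite RRe_real// ger0_real// lA.
pose B : set R := [set complex.Re x | x in A].
have B0 : B !=set0 by case: A0 => x Ax; exists (complex.Re x); exists x.
have lB : lbound B 0.
  by move=> _ [x Ax <-]; have := lA _ Ax; rewrite {1}(reA _ Ax) lecR.
exists (inf B)%:C%C; split => [x Ax|y yA].
  rewrite (reA _ Ax) lecR; apply: ge_inf; first by exists 0.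
  by exists x.
have [x Ax] := A0.
have ryE : y = (complex.Re y)%:C%C.
  have := yA _ Ax; rewrite (reA _ Ax) lecE /= => /andP[/eqP y0 _].
  by case: y y0 {yA} => a b /= <-.
rewrite ryE lecR; apply: lb_le_inf => // _ [z Az <-].
by have := yA _ Az; rewrite {1}ryE (reA _ Az) lecR.
Qed.

Lemma infimumP A : A !=set0 -> lbound A 0 -> infimums A (infimum 0 A).
Proof.
move=> A0 lA; rewrite /infimum; case: ifPn => [/eqP A_|_].
  by case: A0 => y; rewrite A_.
by case: xgetP => [y -> //|N]; have [y /N] := infimums_neq0 A0 lA.
Qed.

Lemma infimum_lb A x : lbound A 0 -> A x -> infimum 0 A <= x.
Proof. by move=> lA Ax; have [|+ _] := infimumP _ lA; [exists x|exact]. Qed.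

Lemma infimum_glb A x : A !=set0 -> lbound A 0 -> lbound A x -> x <= infimum 0 A.
Proof. by move=> A0 lA xA; have [_] := infimumP A0 lA; exact. Qed.

Lemma supremums_neq0 A : lbound A 0 -> A !=set0 -> has_ubound A ->
  supremums A !=set0.
Proof.
move=> lA [a Aa] [M AM].
have [||s [sA sub]] := @infimums_neq0 (ubound A).
- by exists M.
- by move=> x xA; exact: le_trans (lA _ Aa) (xA _ Aa).
- by exists s; split=> // x Ax; apply: sub => y; exact.
Qed.

Lemma supremumP A : lbound A 0 -> A !=set0 -> has_ubound A ->
  supremums A (supremum 0 A).
Proof.
move=> lA A0 uA; rewrite /supremum; case: ifPn => [/eqP A_|_].
  by case: A0 => y; rewrite A_.
by case: xgetP => [y -> //|N]; have [y /N] := supremums_neq0 lA A0 uA.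
Qed.

Lemma supremum_ub A x : lbound A 0 -> has_ubound A -> A x -> x <= supremum 0 A.
Proof.
by move=> lA uA Ax; have [|+ _] := supremumP lA _ uA; [exists x|exact].
Qed.

Lemma supremum_lub A x : lbound A 0 -> A !=set0 -> ubound A x ->
  supremum 0 A <= x.
Proof.
by move=> lA A0 xA; have [|_] := supremumP lA A0; [exists x|exact].
Qed.

End Infimum.

Section BoundedOperators.
Variables (R : realType) (F : scalars).
Local Notation K := (scalar_field R F).
Variable X : normedModType K.

Definition bounded_linear (f : X -> X) : Prop :=
  linear f /\ exists M : K, forall x, `|f x| <= M * `|x|.

Definition bounded_linear_pred : {pred (X -> X)} :=
  fun f => `[< bounded_linear f >].

Lemma bounded_linear_submod_closed : submod_closed bounded_linear_pred.
Proof.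
split.
  apply/asboolP; split; first by move=> a u v; rewrite scaler0 addr0.
  by exists 0 => x; rewrite mul0r normr0.
move=> a f g /asboolP[lf [M fM]] /asboolP[lg [N gN]]; apply/asboolP; split.
  move=> b u v; rewrite /= -[LHS]/(a *: f (b *: u + v) + g (b *: u + v)).
  rewrite lf lg -[RHS]/(b *: (a *: f u + g u) + (a *: f v + g v)).
  by rewrite !scalerDr !scalerA mulrC addrACA.
exists (`|a| * M + N) => x; rewrite -[_ x]/(a *: f x + g x).
rewrite (le_trans (ler_normD _ _))// mulrDl lerD// normrZ -mulrA.
by rewrite ler_wpM2l.
Qed.

HB.instance Definition _ := GRing.isSubmodClosed.Build K (X -> X)
  bounded_linear_pred bounded_linear_submod_closed.

Record bounded_op := BoundedOp {
  bounded_op_fun :> X -> X;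
  bounded_opP : bounded_op_fun \in bounded_linear_pred }.

HB.instance Definition _ := [isSub for bounded_op_fun].
HB.instance Definition _ := [Choice of bounded_op by <:].
HB.instance Definition _ := [SubChoice_isSubLmodule of bounded_op by <:].

Lemma bounded_op_linear (T : bounded_op) : linear T.
Proof. by have /asboolP[] := bounded_opP T. Qed.

HB.instance Definition _ (T : bounded_op) :=
  GRing.isLinear.Build K X X _ (bounded_op_fun T) (bounded_op_linear T).

Definition opnorm (T : bounded_op) : K :=
  supremum 0 [set `|T x| | x in [set x : X | `|x| <= 1]].

Implicit Types S T : bounded_op.

Lemma bounded_opD S T x : (S + T) x = S x + T x. Proof. by []. Qed.
Lemma bounded_opN T x : (- T) x = - T x. Proof. by []. Qed.
Lemma bounded_opZ a T x : (a *: T) x = a *: T x. Proof. by []. Qed.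

Let im T := [set `|T x| | x in [set x : X | `|x| <= 1]].

Let im_ge0 T : lbound (im T) 0. Proof. by move=> _ [x _ <-]. Qed.

Let im_neq0 T : im T !=set0.
Proof. by exists `|T 0|; exists 0 => //=; rewrite normr0 ler01. Qed.

Let im_bounded T : has_ubound (im T).
Proof.
have /asboolP[_ [M TM]] := bounded_opP T; exists `|M| => _ [x /= x1 <-].
have Mx : M * `|x| \is Num.real by apply: ger0_real (le_trans _ (TM x)).
apply: (le_trans (TM x)).
apply: (le_trans (real_ler_norm Mx)); rewrite normrM normr_id.
by rewrite ler_piMr.
Qed.

Lemma opnorm_ge0 T : 0 <= opnorm T.
Proof.
have [_ [x x1 _]] := im_neq0 T; apply: (le_trans (normr_ge0 (T x))).
by apply: (supremum_ub (@im_ge0 T) (im_bounded T)); exists x.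
Qed.

Lemma opnorm_unit T x : `|x| <= 1 -> `|T x| <= opnorm T.
Proof.
by move=> x1; apply: (supremum_ub (@im_ge0 T) (im_bounded T)); exists x.
Qed.

Lemma opnorm_lub T M : (forall x, `|x| <= 1 -> `|T x| <= M) -> opnorm T <= M.
Proof.
move=> TM; apply: (supremum_lub (@im_ge0 T) (im_neq0 T)) => _ [x x1 <-].
exact: TM.
Qed.

Lemma opnorm_le T x : `|T x| <= opnorm T * `|x|.
Proof.
have [->|x0] := eqVneq x 0; first by rewrite linear0 !normr0 mulr0.
rewrite -ler_pdivrMr ?normr_gt0//.
have <- : `|T (`|x|^-1 *: x)| = `|T x| / `|x|.
  by rewrite linearZ normrZ normrV ?unitfE ?normr_eq0// normr_id mulrC.
apply: opnorm_unit.
by rewrite normrZ normrV ?unitfE ?normr_eq0// normr_id mulVf ?normr_eq0.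
Qed.

Lemma ler_opnormD S T : opnorm (S + T) <= opnorm S + opnorm T.
Proof.
apply: opnorm_lub => x x1; rewrite bounded_opD (le_trans (ler_normD _ _))//.
by rewrite lerD// opnorm_unit.
Qed.

Let opnormZ_le a T : opnorm (a *: T) <= `|a| * opnorm T.
Proof.
by apply: opnorm_lub => x x1; rewrite bounded_opZ normrZ ler_wpM2l// opnorm_unit.
Qed.

Lemma opnormZ a T : opnorm (a *: T) = `|a| * opnorm T.
Proof.
apply/eqP; rewrite eq_le opnormZ_le /=; have [->|a0] := eqVneq a 0.
  by rewrite normr0 mul0r opnorm_ge0.
rewrite -ler_pdivlMl ?normr_gt0// -normfV.
by rewrite -{1}[T]scale1r -(mulVf a0) -scalerA.
Qed.

Lemma opnorm0_eq0 T : opnorm T = 0 -> T = 0.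
Proof.
move=> T0; apply/val_inj/funext => x; apply/eqP.
by rewrite -normr_le0 (le_trans (opnorm_le T x))// T0 mul0r.
Qed.

HB.instance Definition _ := Lmodule_isNormed.Build K bounded_op
  ler_opnormD opnormZ opnorm0_eq0.

Definition compact_op (T : bounded_op) : Prop :=
  precompact [set T x | x in [set x : X | `|x| <= 1]].

Definition compact_op_pred : {pred bounded_op} := fun T => `[< compact_op T >].

Lemma compact_op_submod_closed : submod_closed compact_op_pred.
Proof.
have hX : hausdorff_space X by exact: norm_hausdorff.
split.
  apply/asboolP; apply: (@precompact_subset _ _ [set 0]).
    by move=> _ [x _ <-].
  exact/compact_precompact/compact_set1.
move=> a S T /asboolP Sc /asboolP Tc; apply/asboolP.
move: Sc Tc; rewrite /compact_op !precompactE => Sc Tc; rewrite -precompactE.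
pose g (p : X * X) := a *: p.1 + p.2.
apply: (@precompact_subset _ _ (g @` (closure (S @` [set x | `|x| <= 1])
                                  `*` closure (T @` [set x | `|x| <= 1])))).
  move=> _ [x x1 <-]; exists (S x, T x) => //=.
  by split; apply: subset_closure; exists x.
apply: compact_precompact => //; apply: continuous_compact; last exact: compact_setX.
apply: continuous_subspaceT => p; apply: cvgD; last exact: cvg_snd.
by apply: cvgZ; [exact: cvg_cst|exact: cvg_fst].
Qed.

HB.instance Definition _ := GRing.isSubmodClosed.Build K bounded_op
  compact_op_pred compact_op_submod_closed.

End BoundedOperators.

Section Calkin.
Variables (R : realType) (F : scalars).
Local Notation K := (scalar_field R F).
Variable X : completeNormedModType K.
Local Notation BX := (bounded_op X).
Implicit Types (S T : BX).

Lemma compact_op_closed T :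
  (forall e : K, 0 < e -> exists2 S, compact_op S & `|T - S| < e) ->
  compact_op T.
Proof.
move=> Tapprox; rewrite /compact_op precompactE compact_ultra => G GU GT.
suff Gcvg : cvg G.
  exists (lim G); split=> //=.
  by apply: (@closed_cvg _ _ G _ id) Gcvg; first exact: closed_closure.
apply: cauchy_cvg; apply: cauchy_exP => e e0; apply: contrapT => Ge.
have Gball x : G (~` ball x e).
  by have [Gx|//] := in_ultra_setVsetC (ball x e) GU; case: Ge; exists x.
have e4 : 0 < e / 2 / 2 by rewrite !divr_gt0.
have [S Sc TS] := Tapprox _ e4.
move: Sc; rewrite /compact_op precompactE => /compact_near_coveringP Sc.
have {}Sc : \forall i \near G,
    closure [set S x | x in [set x | `|x| <= 1]] `<=` (fun x => ~ ball x (e / 2) i).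
  apply: Sc => x _; exists (ball x (e / 2), ~` ball x e); first split => /=.
  - by apply: nbhsx_ballx; rewrite divr_gt0.
  - exact: Gball.
  - move=> [y i] /= [xy xi] yi; apply: xi.
    by rewrite [e]splitr; apply: ball_triangle yi.
have [i [Si Ti]] := filter_ex (filterI Sc GT).
have [_ [[x x1 <-] iTx]] := Ti _ (nbhsx_ballx i _ e4).
apply: (Si (S x)); first by apply: subset_closure; exists x.
rewrite [e / 2]splitr; apply: (@ball_triangle _ _ (T x)).
  rewrite -ball_normE /= -normrN opprB.
  by apply: le_lt_trans TS; exact: (@opnorm_unit _ _ _ (T - S)).
exact: ball_sym.
Qed.

Definition essnorm T : K :=
  infimum 0 [set `|T - S| | S in [set S : BX | compact_op S]].

Let dist T := [set `|T - S| | S in [set S : BX | compact_op S]].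

Let dist_ge0 T : lbound (dist T) 0. Proof. by move=> _ [S _ <-]. Qed.

Let compact_opP T : compact_op T <-> T \in @compact_op_pred R F X.
Proof. by split=> [Tc|/asboolP//]; exact/asboolP. Qed.

Let compact_op0 : compact_op (0 : BX).
Proof. by rewrite compact_opP rpred0. Qed.

Let compact_opD S T : compact_op S -> compact_op T -> compact_op (S + T).
Proof. by rewrite !compact_opP; exact: rpredD. Qed.

Let compact_opZ a T : compact_op T -> compact_op (a *: T).
Proof. by rewrite !compact_opP; exact: rpredZ. Qed.

Let dist_neq0 T : dist T !=set0.
Proof. by exists `|T - 0|; exists 0. Qed.

Lemma essnorm_ge0 T : 0 <= essnorm T.
Proof. exact: (infimum_glb (dist_neq0 T) (@dist_ge0 T) (@dist_ge0 T)). Qed.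

Lemma essnorm_le T S : compact_op S -> essnorm T <= `|T - S|.
Proof. by move=> Sc; apply: (infimum_lb (@dist_ge0 T)); exists S. Qed.

Lemma essnorm_glb T (x : K) :
  (forall S, compact_op S -> x <= `|T - S|) -> x <= essnorm T.
Proof.
move=> xT; apply: (infimum_glb (dist_neq0 T) (@dist_ge0 T)) => _ [S Sc <-].
exact: xT.
Qed.

Lemma ler_essnormD S T : essnorm (S + T) <= essnorm S + essnorm T.
Proof.
rewrite -lerBlDr; apply: essnorm_glb => S' S'c; rewrite lerBlDr [leRHS]addrC -lerBlDr.
apply: essnorm_glb => T' T'c; rewrite lerBlDr [leRHS]addrC.
rewrite (le_trans (essnorm_le _ (compact_opD S'c T'c)))//.
by rewrite opprD addrACA ler_normD.
Qed.

Lemma essnorm_compact T : compact_op T -> essnorm T = 0.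
Proof.
move=> Tc; apply/eqP; rewrite eq_le essnorm_ge0 andbT.
by rewrite -[X in _ <= X](@normr0 _ BX) -(subrr T) essnorm_le.
Qed.

Let essnormZ_le a T : a != 0 -> essnorm (a *: T) <= `|a| * essnorm T.
Proof.
move=> a0; rewrite -ler_pdivrMl ?normr_gt0//; apply: essnorm_glb => S Sc.
rewrite ler_pdivrMl ?normr_gt0// -normrZ scalerBr.
exact/essnorm_le/compact_opZ.
Qed.

Lemma essnormZ a T : essnorm (a *: T) = `|a| * essnorm T.
Proof.
have [->|a0] := eqVneq a 0.
  by rewrite scale0r normr0 mul0r essnorm_compact.
apply/eqP; rewrite eq_le essnormZ_le//= -ler_pdivlMl ?normr_gt0// -normfV.
by rewrite -{1}[T]scale1r -(mulVf a0) -scalerA essnormZ_le// invr_eq0.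
Qed.

Lemma essnorm_eq0 T : essnorm T = 0 -> compact_op T.
Proof.
move=> T0; apply: compact_op_closed => e e0; apply: contrapT => N.
suff : e <= essnorm T by rewrite T0 => /(lt_le_trans e0); rewrite ltxx.
apply: essnorm_glb => S Sc; rewrite real_leNgt ?(gtr0_real e0)// ?normr_real//.
by apply/negP => TSe; apply: N; exists S.
Qed.

Lemma essnorm_mod S T : compact_op (S - T) -> essnorm S = essnorm T.
Proof.
have le U V : compact_op (U - V) -> essnorm U <= essnorm V.
  move=> UV; rewrite -[U](subrK V) (le_trans (ler_essnormD _ _))//.
  by rewrite essnorm_compact// add0r.
move=> ST; have TS : compact_op (T - S).
  by have := compact_opZ (-1) ST; rewrite scaleN1r opprB.
by apply/le_anti/andP; split; exact: le.
Qed.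

(* [Quotient.quot] only quotients the additive group; the scalar multiplication
   and the quotient norm are put on it below.                                *)
Definition calkin : Type := Quotient.quot (@compact_op_pred R F X).

HB.instance Definition _ := Choice.on calkin.
HB.instance Definition _ := GRing.Zmodule.on calkin.
HB.instance Definition _ := EqQuotient.on calkin.

Implicit Types x y : calkin.

Lemma calkin_pi_eqP S T : \pi_calkin S = \pi_calkin T <-> compact_op (S - T).
Proof.
have E : (S - T \in @compact_op_pred R F X) = (S == T %[mod calkin]).
  exact: Quotient.idealrBE.
by rewrite compact_opP E; split=> /eqP.
Qed.

Let calkinP x : {T | x = \pi_calkin T}.
Proof. by exists (repr x); rewrite reprK. Qed.

Let piD S T : \pi_calkin (S + T) = \pi_calkin S + \pi_calkin T.
Proof. exact: Quotient.pi_add. Qed.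

Definition calkin_scale (a : K) x : calkin := \pi_calkin (a *: repr x).

Lemma calkin_piZ a T : \pi_calkin (a *: T) = calkin_scale a (\pi_calkin T).
Proof.
apply/calkin_pi_eqP; rewrite -scalerBr; apply: compact_opZ.
by apply/calkin_pi_eqP; rewrite reprK.
Qed.

Lemma calkin_scalerA a b x :
  calkin_scale a (calkin_scale b x) = calkin_scale (a * b) x.
Proof. by have [T ->] := calkinP x; rewrite -!calkin_piZ scalerA. Qed.

Lemma calkin_scale1r : left_id 1 calkin_scale.
Proof. by move=> x; have [T ->] := calkinP x; rewrite -calkin_piZ scale1r. Qed.

Lemma calkin_scalerDr : right_distributive calkin_scale +%R.
Proof.
move=> a x y; have [S ->] := calkinP x; have [T ->] := calkinP y.
by rewrite -piD -!calkin_piZ scalerDr piD.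
Qed.

Lemma calkin_scalerDl x : {morph calkin_scale^~ x : a b / a + b}.
Proof.
move=> a b; have [T ->] := calkinP x.
by rewrite -!calkin_piZ scalerDl piD.
Qed.

HB.instance Definition _ := GRing.Zmodule_isLmodule.Build K calkin
  calkin_scalerA calkin_scale1r calkin_scalerDr calkin_scalerDl.

Definition calkin_norm x : K := essnorm (repr x).

Lemma calkin_norm_pi T : calkin_norm (\pi_calkin T) = essnorm T.
Proof. by apply/essnorm_mod/calkin_pi_eqP; rewrite reprK. Qed.

Lemma ler_calkin_normD x y :
  calkin_norm (x + y) <= calkin_norm x + calkin_norm y.
Proof.
have [S ->] := calkinP x; have [T ->] := calkinP y.
by rewrite -piD !calkin_norm_pi ler_essnormD.
Qed.

Lemma calkin_normZ (a : K) x : calkin_norm (a *: x) = `|a| * calkin_norm x.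
Proof.
have [T ->] := calkinP x.
by rewrite -[_ *: _]calkin_piZ !calkin_norm_pi essnormZ.
Qed.

Lemma calkin_norm0_eq0 x : calkin_norm x = 0 -> x = 0.
Proof.
have [T ->] := calkinP x; rewrite calkin_norm_pi => /essnorm_eq0 Tc.
have -> : 0 = \pi_calkin 0 by apply: (addrI (\pi_calkin 0)); rewrite -piD !addr0.
by apply/calkin_pi_eqP; rewrite subr0.
Qed.

HB.instance Definition _ := Lmodule_isNormed.Build K calkin
  ler_calkin_normD calkin_normZ calkin_norm0_eq0.

Lemma normr_calkin_pi T : `|\pi_calkin T| = essnorm T.
Proof. exact: calkin_norm_pi. Qed.

End Calkin.

(* A pair p in C stands for the open ball of center p.1 and radius p.2. *)
Definition ball_covering_property (K : numFieldType) (Z : normedModType K) :=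
  exists C : set (Z * K), [/\ countable C,
    forall p, C p -> 0 < p.2 /\ p.2 <= `|p.1| &
    [set z : Z | `|z| = 1] `<=` \bigcup_(p in C) ball p.1 p.2].

Section Bases.
Variables (K : numFieldType) (X : normedModType K).
Implicit Types (e : nat -> X) (a b : nat -> K) (C : K).

Definition basis_expansion e a (x : X) :=
  series (fun n => a n *: e n) @ \oo --> x.

Definition schauder_basis e := forall x, exists! a, basis_expansion e a x.

Definition unconditional_bound e C := 1 <= C /\
  forall a b (x y : X), basis_expansion e a x -> basis_expansion e b y ->
    (forall n, `|a n| <= `|b n|) -> `|x| <= C * `|y|.

Definition unconditional_basis e :=
  schauder_basis e /\ exists C, unconditional_bound e C.

Definition is_unconditional_constant e C :=
  unconditional_bound e C /\ lbound (unconditional_bound e) C.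

Definition one_unconditional_basis e :=
  unconditional_basis e /\ is_unconditional_constant e 1.

End Bases.

(* Main.v *)
(* For a set S of indices, 1-unconditionality makes the basis projection P_S a
   contraction. If C is compact then P_[N,oo) C -> 0 in norm, and P_[0,N) T has
   finite rank, so |T|_e <= |P_[N,oo) T| for every N, and |T|_e is
   (asymptotically) attained on blocks P_[n,m) T with n arbitrarily large.

   Given countably many operators T_i, choose successive blocks [n_s, m_s) such
   that P_[n_s,m_s) T_i has norm > |T_i|_e - 1/(n_s + 1) for all i <= n_s, leaving
   an index k_s out between consecutive blocks. Let A be the set of the k_s. The
   blocks do not meet A, so P_[n_s,m_s) (T_i - P_A) = P_[n_s,m_s) T_i, and hence
   |T_i - P_A|_e >= |T_i|_e for all i, while |P_A|_e = 1: no ball around some T_i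
   that avoids the origin contains P_A. *)
Require Import Defs.
From mathcomp Require Import all_boot all_order all_algebra.
From mathcomp Require Import generic_quotient ring_quotient complex.
From mathcomp Require Import all_classical all_reals topology.
From mathcomp Require Import normedtype sequences.

Set Implicit Arguments.
Unset Strict Implicit.
Unset Printing Implicit Defensive.

Import Order.TTheory GRing.Theory Num.Theory.
Import numFieldNormedType.Exports.

Local Open Scope classical_set_scope.
Local Open Scope ring_scope.

(** * Coordinate projections of a 1-unconditional basis *)

Definition restrict_coef (V : nmodType) (S : pred nat) (a : nat -> V) : nat -> V :=
  fun n => if S n then a n else 0.

Definition coef (K : numFieldType) (X : normedModType K) (e : nat -> X) (x : X) :
    nat -> K :=
  xget (fun=> 0) [set a | basis_expansion e a x].

(** Taking [lim] makes the projection total. That the series converges for every [S] is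
    [basis_proj_expansion], which rests on unconditionality and completeness. *)
Definition basis_proj (K : numFieldType) (X : completeNormedModType K)
    (e : nat -> X) (S : pred nat) (x : X) : X :=
  lim (series (fun n => restrict_coef S (coef e x) n *: e n) @ \oo).

Section BasisProjection.
Variables (K : numFieldType) (X : completeNormedModType K) (e : nat -> X).

Lemma basis_expansion_unique a x y :
  basis_expansion e a x -> basis_expansion e a y -> x = y.
Proof. exact: cvg_unique. Qed.
(* [basis_expansion] unfolds to a product, so that by default these lemmas get
   too many implicit arguments. *)
Arguments basis_expansion_unique {a x y}.

Lemma basis_expansion_lin c a b x y :
  basis_expansion e a x -> basis_expansion e b y ->
  basis_expansion e (fun n => c * a n + b n) (c *: x + y).
Proof.
rewrite /basis_expansion => ax yb.
have -> : series (fun n => (c * a n + b n) *: e n) =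
    (fun n => c *: series (fun n => a n *: e n) n + series (fun n => b n *: e n) n).
  apply/funext => n; rewrite /series /= scaler_sumr -big_split /=.
  by apply: eq_bigr => i _; rewrite scalerDl scalerA.
by apply: cvgD => //; apply: cvgZl_tmp.
Qed.

Lemma basis_expansion_fin a N : (forall n, (N <= n)%N -> a n = 0) ->
  basis_expansion e a (\sum_(0 <= n < N) a n *: e n).
Proof.
move=> aN; apply: cvg_near_cst; exists N => // n /= Nn.
rewrite /series /= (big_cat_nat (leq0n N) Nn)//= [X in _ + X]big_nat [X in _ + X]big1 ?addr0// => i.
by move=> /andP[Ni _]; rewrite aN// scale0r.
Qed.

Arguments basis_expansion_lin c {a b x y}.
Arguments basis_expansion_fin {a}.

Lemma basis_expansion0 : basis_expansion e (fun=> 0) 0.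
Proof.
by have := @basis_expansion_fin (fun=> 0) 0 (fun _ _ => erefl); rewrite big_geq.
Qed.

Lemma basis_expansion_delta k : basis_expansion e (fun n => (n == k)%:R) (e k).
Proof.
have -> : e k = \sum_(0 <= n < k.+1) (n == k)%:R *: e n.
  rewrite big_nat_recr//= eqxx scale1r big_nat big1 ?add0r// => i /andP[_ ik].
  by rewrite ltn_eqF// scale0r.
by apply: basis_expansion_fin => n kn; rewrite gtn_eqF.
Qed.

Arguments basis_expansion_delta : clear implicits.

Hypothesis basis_e : schauder_basis e.

Lemma coef_expansion x : basis_expansion e (coef e x) x.
Proof.
rewrite /coef; case: xgetP => [a -> //|N].
by have [a [ax _]] := basis_e x; case: (N a ax).
Qed.

Arguments coef_expansion : clear implicits.

Lemma coef_unique a x : basis_expansion e a x -> coef e x = a.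
Proof.
have [b [_ bu]] := basis_e x => ax.
by rewrite -(bu a ax); apply/esym/bu; exact: coef_expansion.
Qed.

(** Serves as an extensionality principle: identities between projections are checked coefficient by
    coefficient. *)
Lemma coef_inj : injective (coef e).
Proof.
move=> x y xy; apply: basis_expansion_unique (coef_expansion x) _.
by rewrite xy; exact: coef_expansion.
Qed.

Lemma coef_lin c x y n : coef e (c *: x + y) n = c * coef e x n + coef e y n.
Proof.
by rewrite (coef_unique (basis_expansion_lin c (coef_expansion x) (coef_expansion y))).
Qed.

Lemma basis_neq0 k : e k != 0.
Proof.
apply/eqP => ek0; have /(congr1 (@^~ k)) /= := coef_unique (basis_expansion_delta k).
have -> : coef e (e k) = fun=> 0.
  by rewrite ek0; exact: coef_unique basis_expansion0.
by rewrite eqxx => /eqP; rewrite eq_sym oner_eq0.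
Qed.

Hypothesis uncond_e : unconditional_bound e 1.
Local Notation coef := (coef e).
Local Notation proj := (basis_proj e).
Implicit Types S T : pred nat.

Lemma uncond_norm_le a b x y : basis_expansion e a x -> basis_expansion e b y ->
  (forall n, `|a n| <= `|b n|) -> `|x| <= `|y|.
Proof.
by move=> ax yb ab; have [_ h] := uncond_e; rewrite -[leRHS]mul1r; exact: h ab.
Qed.

Lemma norm_restrict_coef S (a : nat -> K) n : `|restrict_coef S a n| <= `|a n|.
Proof. by rewrite /restrict_coef; case: ifP; rewrite ?normr0. Qed.

(** A finite block, padded with zero coefficients, is a basis expansion of its own sum, so the
    unconditional bound applies before any convergence of the restricted series is known. *)
Lemma norm_sum_restrict_coef S a n m :
  `|\sum_(n <= k < m) restrict_coef S a k *: e k| <= `|\sum_(n <= k < m) a k *: e k|.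
Proof.
have cut b : basis_expansion e (restrict_coef (fun k => n <= k < m)%N b)
    (\sum_(n <= k < m) b k *: e k).
  have -> : \sum_(n <= k < m) b k *: e k =
      \sum_(0 <= k < m) restrict_coef (fun k => n <= k < m)%N b k *: e k.
    rewrite (big_nat_widenl _ 0)// big_mkcond big_nat [RHS]big_nat.
    apply: eq_bigr => k /andP[_ km]; rewrite /restrict_coef km andbT.
    by case: (n <= k)%N; rewrite ?scale0r.
  by apply: basis_expansion_fin => k mk; rewrite /restrict_coef ltnNge mk andbF.
apply: uncond_norm_le (cut _) (cut _) _ => k.
by rewrite {1 3}/restrict_coef; case: ifP => // _; exact: norm_restrict_coef.
Qed.

(** Blocks of the restricted series are dominated by the same blocks of the convergent expansion of
    [x], so the series is Cauchy. *)
Lemma basis_proj_expansion S x :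
  basis_expansion e (restrict_coef S (coef x)) (proj S x).
Proof.
apply: cauchy_cvg; apply/cauchy_seriesP => eps eps0.
have /cvg_cauchy/cauchy_seriesP/(_ _ eps0) : cvg (series (fun n => coef x n *: e n) @ \oo).
  by apply/cvg_ex; exists x; exact: coef_expansion.
by apply: filterS => -[n m] /=; apply: le_lt_trans (norm_sum_restrict_coef _ _ _ _).
Qed.

Arguments basis_proj_expansion : clear implicits.

Lemma coef_proj S x : coef (proj S x) = restrict_coef S (coef x).
Proof. exact/coef_unique/basis_proj_expansion. Qed.

Lemma basis_proj_linear S : linear (proj S).
Proof.
move=> c x y; apply: (coef_inj); apply/funext => n.
rewrite coef_proj coef_lin// !coef_proj /restrict_coef coef_lin//.
by case: ifP; rewrite // mulr0 addr0.
Qed.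

Lemma basis_projB S x y : proj S (x - y) = proj S x - proj S y.
Proof.
by rewrite addrC -scaleN1r basis_proj_linear scaleN1r addrC.
Qed.

Lemma basis_projZ S c x : proj S (c *: x) = c *: proj S x.
Proof. exact: scalable_linear (basis_proj_linear S) c x. Qed.

Lemma basis_proj_proj S T x : proj S (proj T x) = proj (predI S T) x.
Proof.
apply: (coef_inj); apply/funext => n.
by rewrite !coef_proj /restrict_coef /=; case: (S n).
Qed.

Lemma norm_basis_proj S x : `|proj S x| <= `|x|.
Proof.
apply: uncond_norm_le (basis_proj_expansion S x) (coef_expansion x) _.
exact: norm_restrict_coef.
Qed.

Lemma norm_basis_proj_sub S T x : {subset S <= T} -> `|proj S x| <= `|proj T x|.
Proof.
move=> ST; have -> : S = predI S T; last by rewrite -basis_proj_proj norm_basis_proj.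
apply/funext => n /=; apply/idP/idP => [Sn|/andP[]//].
by rewrite Sn; exact: ST.
Qed.

Lemma basis_proj0 S x : (forall n, S n = false) -> proj S x = 0.
Proof.
move=> S0; apply: (coef_inj); apply/funext => n.
rewrite coef_proj /restrict_coef S0.
by rewrite -[0 in RHS](addNr x) -scaleN1r coef_lin// mulN1r addNr.
Qed.

Lemma basis_projT_sub S x : x - proj S x = proj (predC S) x.
Proof.
apply: (coef_inj); apply/funext => n.
rewrite addrC -scaleN1r coef_lin// !coef_proj /restrict_coef /=.
by case: (S n); rewrite ?mulr0 ?add0r// mulN1r addNr.
Qed.

Lemma basis_proj_delta S k : S k -> proj S (e k) = e k.
Proof.
move=> Sk; apply: (coef_inj); apply/funext => n.
rewrite coef_proj /restrict_coef (coef_unique (basis_expansion_delta k)).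
by case: eqVneq => [->|_]; [rewrite Sk|case: ifP].
Qed.

Lemma basis_proj_initial n x : proj (ltn^~ n) x = \sum_(0 <= k < n) coef x k *: e k.
Proof.
apply: (basis_expansion_unique (basis_proj_expansion _ _)).
rewrite (eq_big_nat _ _ (F2 := fun k => restrict_coef (ltn^~ n) (coef x) k *: e k)).
  by apply: basis_expansion_fin => k nk; rewrite /restrict_coef /= ltnNge nk.
by move=> k /andP[_ kn]; rewrite /restrict_coef /= kn.
Qed.

Lemma basis_proj_initial_cvg x : proj (ltn^~ n) x @[n --> \oo] --> x.
Proof.
have -> : (fun n => proj (ltn^~ n) x) = series (fun n => coef x n *: e n).
  by apply/funext => n; rewrite basis_proj_initial.
exact: coef_expansion.
Qed.

Lemma basis_proj_tail_cvg x : proj (leq n) x @[n --> \oo] --> (0 : X).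
Proof.
have -> : (fun n => proj (leq n) x) = (fun n => x - proj (ltn^~ n) x).
  apply/funext => n; rewrite basis_projT_sub; congr (proj _ x).
  by apply/funext => k /=; rewrite -leqNgt.
by rewrite -(subrr x); apply: cvgB; [exact: cvg_cst|exact: basis_proj_initial_cvg].
Qed.

Lemma basis_proj_single k x : proj (pred1 k) x = coef x k *: e k.
Proof.
apply: (basis_expansion_unique (basis_proj_expansion _ _)).
have := basis_expansion_lin (coef x k) (basis_expansion_delta k) basis_expansion0.
rewrite addr0; congr (basis_expansion e _ _); apply/funext => n.
by rewrite /restrict_coef addr0 /=; case: eqP => [->|]; rewrite ?mulr1 ?mulr0.
Qed.

Lemma norm_coef_le k x : `|coef x k| * `|e k| <= `|x|.
Proof. by rewrite -normrZ -basis_proj_single norm_basis_proj. Qed.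

(** Tails tend to 0 pointwise and tail projections are contractions. Hence a bound [eps / 2] at [x]
    gives [eps] on a ball around [x], and compactness of the closure makes the rank uniform. *)
Lemma precompact_proj_tail (A : set X) eps : precompact A -> 0 < eps ->
  exists N, forall x, A x -> `|proj (leq N) x| < eps.
Proof.
rewrite precompactE => /compact_near_coveringP Ac eps0.
have : \forall n \near \oo, closure A `<=` (fun x => `|proj (leq n) x| < eps).
  apply: Ac => x _.
  have eps2 : 0 < eps / 2 by rewrite divr_gt0.
  have /cvgr0Pnorm_lt/(_ _ eps2) xn := basis_proj_tail_cvg x.
  exists (ball x (eps / 2), [set n | `|proj (leq n) x| < eps / 2]).
    by split => //=; exact: nbhsx_ballx.
  move=> [y n] /= []; rewrite -ball_normE /= => xy nx.
  have -> : y = x - (x - y) by rewrite opprB addrC subrK.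
  rewrite basis_projB (le_lt_trans (ler_normB _ _))// [eps]splitr ltrD//.
  exact: le_lt_trans (norm_basis_proj _ _) xy.
by move=> [N _ /(_ N (leqnn N)) NA]; exists N => x Ax; apply/NA/subset_closure.
Qed.

End BasisProjection.

(** * Archimedean property and compact disks for real or complex scalars *)

(** A positive complex number is real, so the complex case reduces to that of [R]. *)
Lemma scalar_inv_nat_lt (R : realType) (F : scalars) (eps : scalar_field R F) :
  0 < eps -> exists n, n.+1%:R^-1 < eps.
Proof.
have real_case (r : R) : 0 < r -> exists n, n.+1%:R^-1 < r.
  by move=> r0; have [n] := ltr_add_invr r0; rewrite add0r; exists n.
case: F eps => /= [|eps eps0]; first exact: real_case.
have epsE : eps = (complex.Re eps)%:C%C by rewrite RRe_real// gtr0_real.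
have [|n nr] := real_case (complex.Re eps); first by move: eps0; rewrite epsE ltcR.
exists n; rewrite epsE; move: nr; rewrite -ltcR; congr (_ < _).
by rewrite fmorphV rmorph_nat.
Qed.

(** In the real case the disk is a segment; in the complex case it lies in the continuous image of a
    compact square. *)
Lemma scalar_disk_precompact (R : realType) (F : scalars) (M : scalar_field R F) :
  precompact [set c : scalar_field R F | `|c| <= M].
Proof.
case: F M => /= M.
  apply: (@precompact_subset _ _ `[- M, M]%classic).
    by move=> c /=; rewrite ler_norml in_itv.
  by apply: compact_precompact; [exact: norm_hausdorff|exact: segment_compact].
pose r := complex.Re M.
pose f (p : R * R) : scalar_field R complex_scalars := (p.1 +i* p.2)%C.
apply: (@precompact_subset _ _ (f @` (`[- r, r]%classic `*` `[- r, r]%classic))).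
  move=> [a b] /= cM; have M0 : 0 <= M by exact: le_trans cM.
  have ME : M = r%:C%C by rewrite RRe_real// ger0_real.
  have lerM x : (`|x|%:C%C <= M) -> x \in `[- r, r].
    by rewrite ME lecR ler_norml in_itv.
  exists (a, b) => //=; split => /=; apply: lerM; apply: le_trans cM.
    exact: (normc_ge_Re (a +i* b)%C).
  rewrite normc_def /= lecR -[X in X <= _]sqrtr_sqr.
  by rewrite ler_sqrt ?addr_ge0 ?sqr_ge0// lerDr sqr_ge0.
apply: compact_precompact; first exact: norm_hausdorff.
apply: continuous_compact; last by apply: compact_setX; exact: segment_compact.
apply: continuous_subspaceT => p; apply/cvgrPdist_lt => eps eps0.
have epsE : eps = (complex.Re eps)%:C%C by rewrite RRe_real// gtr0_real.
have e2 : 0 < complex.Re eps / 2 by rewrite divr_gt0//; move: eps0; rewrite epsE ltcR.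
have dist (u v : R) : `|u%:C%C - v%:C%C| = `|u - v|%:C%C.
  by rewrite -rmorphB normc_def /= expr0n addr0 sqrtr_sqr.
exists (ball p.1 (complex.Re eps / 2), ball p.2 (complex.Re eps / 2)).
  by split; exact: nbhsx_ballx.
move=> [a b] []; rewrite -!ball_normE /= => pa pb.
(* Real and imaginary parts each contribute less than [eps / 2]. *)
have -> : f p - f (a, b) = (p.1%:C%C - a%:C%C) + 'i%C * (p.2%:C%C - b%:C%C).
  by rewrite /f; simpc.
rewrite (le_lt_trans (ler_normD _ _))// normrM !dist.
have -> : `|'i%C : R[i]| = 1 by rewrite normc_def /= expr0n add0r expr1n sqrtr1.
by rewrite mul1r -rmorphD epsE ltcR [ltRHS]splitr ltrD.
Qed.

(** * Compactness of rank-one operators; composition of bounded operators *)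

Section CompactOperators.
Variables (R : realType) (F : scalars).
Local Notation K := (scalar_field R F).
Variable X : completeNormedModType K.
Implicit Types S T : bounded_op X.

Lemma compact_op_rank_one T (phi : X -> K) (M : K) (v : X) :
  (forall x, T x = phi x *: v) -> (forall x, `|x| <= 1 -> `|phi x| <= M) ->
  compact_op T.
Proof.
move=> Tphi phiM; have disk := scalar_disk_precompact M.
rewrite precompactE in disk.
apply: (@precompact_subset _ _
  ((fun c : K => c *: v) @` closure [set c : K | `|c| <= M])).
  move=> _ [x /phiM xM <-]; exists (phi x); last by rewrite Tphi.
  exact: subset_closure.
apply: compact_precompact; first exact: norm_hausdorff.
apply: continuous_compact => //; apply: continuous_subspaceT.
exact: scalel_continuous.
Qed.

Lemma compact_opD S T : compact_op S -> compact_op T -> compact_op (S + T).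
Proof.
move=> Sc Tc.
have Sp : S \in @compact_op_pred R F X by exact/asboolP.
have Tp : T \in @compact_op_pred R F X by exact/asboolP.
by have /asboolP := rpredD Sp Tp.
Qed.

Lemma bounded_linear_comp S T : bounded_linear (S \o T).
Proof.
split; first by move=> a x y /=; rewrite linearP linearP.
exists (opnorm S * opnorm T) => x /=; rewrite (le_trans (opnorm_le _ _))// -mulrA.
by rewrite ler_wpM2l ?opnorm_ge0// opnorm_le.
Qed.

Definition comp_op S T : bounded_op X := BoundedOp (asboolT (bounded_linear_comp S T)).

End CompactOperators.

(** * The essential norm through blocks of the basis *)

Section EssentialNorm.
Variables (R : realType) (F : scalars).
Local Notation K := (scalar_field R F).
Variables (X : completeNormedModType K) (e : nat -> X).
Hypothesis basis_e : schauder_basis e.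
Hypothesis uncond_e : unconditional_bound e 1.
Local Notation proj := (basis_proj e).
Implicit Types (S : pred nat) (T : bounded_op X).

Lemma bounded_linear_proj S : bounded_linear (proj S).
Proof.
split; first exact: basis_proj_linear.
by exists 1 => x; rewrite mul1r norm_basis_proj.
Qed.

Definition proj_op S : bounded_op X := BoundedOp (asboolT (bounded_linear_proj S)).

(** Each further index adds one rank-one operator, whose coefficient functional is bounded by
    [norm_coef_le]. *)
Lemma compact_op_proj_initial n T : compact_op (comp_op (proj_op (ltn^~ n)) T).
Proof.
elim: n => [|n IHn].
  apply: (@compact_op_rank_one _ _ _ _ (fun=> 0) 0 0) => x; last by rewrite normr0.
  by rewrite scaler0 /= basis_proj0.
pose E := comp_op (proj_op (pred1 n)) T.
have -> : comp_op (proj_op (ltn^~ n.+1)) T = comp_op (proj_op (ltn^~ n)) T + E.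
  apply/val_inj/funext => x; rewrite -[RHS]/(proj (ltn^~ n) (T x) + proj (pred1 n) (T x)).
  by rewrite /= !basis_proj_initial// basis_proj_single// big_nat_recr.
apply: compact_opD => //.
apply: (@compact_op_rank_one _ _ _ E (fun x => coef e (T x) n)
  (opnorm T / `|e n|) (e n)) => x; first by rewrite /= basis_proj_single.
move=> x1; rewrite ler_pdivlMr ?normr_gt0 ?basis_neq0//.
exact: le_trans (norm_coef_le _ _ _ _) (opnorm_unit _ x1).
Qed.

Lemma essnorm_le_tail n T :
  essnorm T <= opnorm (comp_op (proj_op (leq n)) T).
Proof.
have := essnorm_le T (compact_op_proj_initial n T); congr (_ <= _).
congr (opnorm _); apply/val_inj/funext => x.
rewrite -[LHS]/(T x - proj (ltn^~ n) (T x)) basis_projT_sub//=.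
by congr (proj _ _); apply/funext => k /=; rewrite -leqNgt.
Qed.

Lemma essnorm_real T : essnorm T \is Num.real.
Proof. exact/ger0_real/essnorm_ge0. Qed.

(** By [essnorm_le_tail] some tail of a [T x] has norm above [essnorm T - eps]; the inequality is
    strict, so it survives cutting the tail at a large [m]. *)
Lemma exists_block T n (eps : K) : 0 < eps -> exists m x,
  `|x| <= 1 /\ essnorm T - eps < `|proj (fun k => n <= k < m)%N (T x)|.
Proof.
move=> eps0.
have d_real : essnorm T - eps \is Num.real.
  by rewrite rpredB ?essnorm_real// gtr0_real.
have [x [x1 xT]] : exists x, `|x| <= 1 /\ essnorm T - eps < `|proj (leq n) (T x)|.
  apply: contrapT => /forallNP N.
  suff : essnorm T <= essnorm T - eps by rewrite lerDl oppr_ge0 lt_geF.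
  apply: (le_trans (essnorm_le_tail n T)); apply: opnorm_lub => x x1.
  by rewrite real_leNgt ?normr_real//; apply/negP => xT; apply: (N x).
set y := proj (leq n) (T x) in xT.
have /cvgrPdist_lt/(_ (`|y| - (essnorm T - eps))) :
  proj (ltn^~ n) y @[n --> \oo] --> y by exact: basis_proj_initial_cvg.
rewrite subr_gt0 => /(_ xT)[m _ /(_ m (leqnn m))] /= ym.
exists m, x; split=> //.
have -> : proj (fun k => n <= k < m)%N (T x) = proj (ltn^~ m) y.
  rewrite basis_proj_proj//; congr (proj _ _).
  by apply/funext => k /=; rewrite andbC.
have : `|y| <= `|y - proj (ltn^~ m) y| + `|proj (ltn^~ m) y|.
  by rewrite -[X in `|X| <= _](subrK (proj (ltn^~ m) y)) ler_normD.
rewrite -lerBlDl; apply: lt_le_trans.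
by rewrite ltrBrDl -ltrBrDr.
Qed.

(** If a compact [C] had [|T - C| < t], take [d] to be half the gap. On far blocks [C] contributes
    less than [d], so the block norm is below [|T - C| + d = t - d], a contradiction. *)
Lemma essnorm_ge_blocks T (t : K) : t \is Num.real ->
  (forall N eps, 0 < eps -> exists S x, [/\ {subset S <= leq N}, `|x| <= 1 &
    t - eps < `|proj S (T x)|]) ->
  t <= essnorm T.
Proof.
move=> t_real blocks; apply: essnorm_glb => C Cc.
rewrite real_leNgt ?normr_real//; apply/negP => TCt.
pose d := (t - `|T - C|) / 2.
have d0 : 0 < d by rewrite divr_gt0// subr_gt0.
have [N NC] := precompact_proj_tail basis_e uncond_e Cc d0.
have [S [x [SN x1 xS]]] := blocks N _ d0.
have : `|proj S (T x)| < `|T - C| + d.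
  have -> : T x = (T - C) x - (- C x) by rewrite opprK; exact/esym/subrK.
  rewrite basis_projB// (le_lt_trans (ler_normB _ _))// ler_ltD//.
    rewrite (le_trans (norm_basis_proj _ _ _ _))//.
    exact: (@opnorm_unit _ _ _ (T - C)).
  rewrite (le_lt_trans (norm_basis_proj_sub basis_e uncond_e _ SN))//.
  (* [- C x] is the image under [C] of [- x], again in the unit ball. *)
  by apply: NC; exists (- x); [rewrite /= normrN|exact: linearN].
by move=> /(lt_trans xS); rewrite ltrBlDr -addrA -splitr addrC subrK ltxx.
Qed.

(** Enlarging a block does not decrease the norm, so the largest of the finitely many right ends
    works for all [i <= n]. *)
Lemma exists_common_block (T_ : nat -> bounded_op X) n : exists m, forall i,
  (i <= n)%N -> exists x, `|x| <= 1 /\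
    essnorm (T_ i) - n.+1%:R^-1 < `|proj (fun k => n <= k < m)%N (T_ i x)|.
Proof.
have n0 : 0 < n.+1%:R^-1 :> K by rewrite invr_gt0 ltr0Sn.
have [m_ mP] := choice (fun i => exists_block (T_ i) n n0).
exists (\max_(i < n.+1) m_ i)%N => i ni; have [x [x1 xT]] := mP i.
exists x; split=> //; apply: lt_le_trans xT _; apply: norm_basis_proj_sub => // k.
rewrite !unfold_in => /andP[-> km]; apply: leq_trans km _.
exact: (@leq_bigmax _ (fun i : 'I_n.+1 => m_ i) (Ordinal (ni : (i < n.+1)%N))).
Qed.

Lemma exists_far_operator (T_ : nat -> bounded_op X) :
  exists P, essnorm P = 1 /\ forall i, essnorm (T_ i) <= essnorm (T_ i - P).
Proof.
have [g gP] := choice (exists_common_block T_).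
(* [b (nu s)] is the index left out after block [s], and the next block starts just after it. The
   maximum with [n] keeps [nu] strictly increasing even when a block is empty. *)
pose b n := maxn n (g n); pose nu s := iter s (fun n => (b n).+1) 0%N.
have nuS s : (nu s < nu s.+1)%N by rewrite /nu /= ltnS leq_maxl.
have nu_le : {homo nu : s t / (s <= t)%N}.
  by apply: homo_leq => [//|? ? ?|s]; [exact: leq_trans|exact: ltnW].
have nu_ge s : (s <= nu s)%N by elim: s => // s IHs; exact: leq_ltn_trans IHs (nuS s).
pose A : pred nat := fun k => `[< exists s, k = b (nu s) >].
(* An index [b (nu t)] lies before block [s] if [t < s], and at or past its right end if
   [s <= t]. *)
have gap s k : (nu s <= k < g (nu s))%N -> A k = false.
  move=> /andP[sk kg]; apply/asboolPn => -[t kE]; have [ts|st|st] := ltngtP t s.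
  - by have := leq_trans (nu_le _ _ ts) sk; rewrite kE ltnn.
  - have := leq_trans (nu_le _ _ st) (leq_maxl _ (g (nu t))).
    rewrite -/(b _) -kE => /(ltn_trans (leq_trans kg (leq_maxr (nu s) _))).
    by rewrite ltnn.
  - by have := leq_trans kg (leq_maxr (nu s) _); rewrite -/(b _) kE st ltnn.
exists (proj_op A); split=> [|i].
  apply/le_anti/andP; split.
    (* The compact operator subtracted here is zero, so the essential norm is at most the operator
       norm. *)
    apply: (le_trans (essnorm_le _ (compact_op_proj_initial 0 (proj_op A)))).
    apply: opnorm_lub => x x1.
    rewrite -[X in `|X|]/(proj A x - proj (ltn^~ 0%N) (proj A x)).
    rewrite [X in _ - X]basis_proj0// subr0.
    exact: le_trans (norm_basis_proj _ _ _ _) x1.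
  (* The block is a single index [k] of [A] with [N <= k], tested on the normalized basis vector,
     which [proj A] fixes. *)
  apply: essnorm_ge_blocks => [//|N eps eps0]; set k := b (nu N).
  have ek0 : `|e k| != 0 by rewrite normr_eq0 basis_neq0.
  exists (pred1 k), (`|e k|^-1 *: e k).
  have ek1 : `| `|e k|^-1 *: e k| = 1 by rewrite normrZ normfV normr_id mulVf.
  have Pe S : S k -> proj S (`|e k|^-1 *: e k) = `|e k|^-1 *: e k.
    by move=> Sk; rewrite basis_projZ// basis_proj_delta.
  split; [|by rewrite ek1|].
  - move=> _ /eqP ->; rewrite unfold_in.
    exact: leq_trans (nu_ge N) (leq_maxl _ _).
  - have Ak : A k by apply/asboolP; exists N.
    by rewrite /= !Pe ?ek1 ?ltrBlDr ?ltrDl//= eqxx.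
apply: (@essnorm_ge_blocks (T_ i - proj_op A)) => [|N eps eps0]; first exact: essnorm_real.
have [M Meps] := scalar_inv_nat_lt eps0.
(* [N] pushes the block far out, [M] brings the error below [eps], and [i] puts [T_ i] among the
   operators that block [s] handles. *)
pose s := maxn (maxn N M) i; have sn := nu_ge s.
have [x [x1 xT]] := gP (nu s) i (leq_trans (leq_maxr _ _) sn).
exists (fun k => nu s <= k < g (nu s))%N, x; split=> //.
  move=> k; rewrite !unfold_in => /andP[+ _]; apply: leq_trans.
  by apply: leq_trans sn; rewrite /s -maxnA leq_maxl.
have -> : (T_ i - proj_op A) x = T_ i x - proj A x by [].
(* The block misses [A], so the term coming from [proj A] vanishes. *)
rewrite basis_projB// basis_proj_proj// [basis_proj e (predI _ _) _]basis_proj0//.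
  rewrite subr0; apply: le_lt_trans xT; rewrite lerD2l lerN2 (le_trans _ (ltW Meps))//.
  rewrite lef_pV2 ?posrE ?ltr0Sn// ler_nat ltnS (leq_trans _ sn)//.
  by rewrite /s (leq_trans _ (leq_maxl _ _))// leq_maxr.
by move=> k /=; case: (boolP (_ <= k < _)%N) => //= /gap.
Qed.

End EssentialNorm.

(** * Failure of the ball covering property *)

Theorem theorem2p5 (R : realType) (F : scalars)
    (X : completeNormedModType (scalar_field R F)) (e : nat -> X) :
  one_unconditional_basis e -> ~ ball_covering_property (calkin X).
Proof.
move=> [[basis_e _] [uncond_e _]] [C [/countable_injP[f f_inj] Crad Ccov]].
(* The injection [f] lists the centers as a sequence; integers that number no ball get the center
   0. *)
pose center n : calkin X := (xget (0, 0) [set p | C p /\ f p = n]).1.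
have centerP p : C p -> center (f p) = p.1.
  move=> Cp; rewrite /center; case: xgetP => [q _ [Cq fqp]|/(_ p)]; last by case.
  by rewrite (f_inj q p) ?inE.
have [P [P1 far]] := exists_far_operator basis_e uncond_e (fun n => repr (center n)).
have [p Cp] := Ccov (\pi_(calkin X)%qT P) (etrans (normr_calkin_pi P) P1).
have [_ rp] := Crad p Cp.
(* The class of [P] would be closer to the center than the center is to 0, against [far]. *)
rewrite -ball_normE /= => /lt_le_trans /(_ rp).
have -> : p.1 = \pi_(calkin X)%qT (repr (center (f p))) by rewrite reprK centerP.
have -> : \pi_(calkin X)%qT (repr (center (f p))) - \pi_(calkin X)%qT P =
    \pi_(calkin X)%qT (repr (center (f p)) - P).
  by rewrite [RHS]Quotient.pi_add Quotient.pi_opp.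
rewrite !normr_calkin_pi => /lt_le_trans/(_ (far _)).
by rewrite ltxx.
Qed.
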